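(* Let $\mathbb{F}$ be any field and $P\in\mathbb{F}[x_1,\dots,x_m]$. Then $P$ is the determinant of an alternating matrix whose entries lie in $\mathbb{F}\cup\{x_1,\dots,x_m\}$ if and only if $P=Q^2$ for some $Q\in\mathbb{F}[x_1,\dots,x_m]$.
   Context: An alternating matrix is a square matrix $M$ with $M^T=-M$ and all diagonal entries equal to $0$.
   Formalization: Entries are allowed in F ∪ {x_1,…,x_m, −x_1,…,−x_m}: since M^T = −M forces −x_k to be an entry whenever x_k is, the claim read literally fails outside characteristic 2 (e.g. for P = x_1^2). *)

(* Defs.v *)
From mathcomp Require Import all_boot all_order all_algebra.
From mathcomp Require Export mpoly.

Set Implicit Arguments.
Unset Strict Implicit.
Unset Printing Implicit Defensive.

Import GRing.Theory.
Local Open Scope ring_scope.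

Definition alternating (R : pzRingType) (n : nat) (M : 'M[R]_n) : Prop :=
  M^T = - M /\ forall i : 'I_n, M i i = 0.

Definition const_or_var (F : fieldType) (m : nat) (p : {mpoly F[m]}) : Prop :=
  (exists c : F, p = c%:MP) \/ (exists k : 'I_m, p = 'X_k).

(* An alternating matrix with an entry x_k also has the entry - x_k, so
   "entries in F \cup {x_1, ..., x_m}" has to be read up to sign: the set of
   entries is the closure F \cup {x_k, - x_k} of the latter under opposite.
   In characteristic 2 this is F \cup {x_1, ..., x_m} itself. *)
Definition entries_const_or_var (F : fieldType) (m n : nat)
    (M : 'M[{mpoly F[m]}]_n) : Prop :=
  forall i j : 'I_n, const_or_var (M i j) \/ const_or_var (- M i j).

(* Main.v *)
(* For an alternating matrix bordering [B] by a row [r], the determinant is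
   [r *m \adj B *m r^T].  If [B] has odd size then it is singular, so [\adj B]
   has rank at most 1; it is symmetric and its diagonal entries are alternating
   minors, hence squares by induction.  Over an integral domain this forces
   [\adj B = p *m p^T], and the determinant is the square of [r *m p]; no unique
   factorization and no Pfaffian is needed.

   Conversely, every polynomial [Q] is [r *m N^-1 *m c] with [\det N = 1] and all
   entries constants or variables up to sign: such expressions are stable under
   sums and under multiplication by a constant or a variable.  Hence [Q] is a
   determinant [\det M], and [block_mx 0 M (- M^T) 0] has determinant [Q ^+ 2]. *)
Require Import Defs.
From mathcomp Require Import all_boot all_order all_algebra.
From mathcomp Require Import mpoly.

Set Implicit Arguments.
Unset Strict Implicit.
Unset Printing Implicit Defensive.

Import GRing.Theory.
Local Open Scope ring_scope.

(** * Bordered determinants and alternating matrices of odd size *)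

(** Expand along the first row, then each remaining minor along its first column. *)
Lemma det_bordered (R : comPzRingType) (n : nat) (r : 'rV[R]_n)
    (c : 'cV[R]_n) (B : 'M[R]_n) :
  \det (block_mx (0 : 'M_1) r c B) = - (r *m \adj B *m c) 0 0.
Proof.
rewrite (expand_det_row _ (lshift n 0)) big_split_ord big_ord1 /=.
rewrite block_mxEul mxE mul0r add0r -mulmxA mxE -sumrN.
apply: eq_bigr => j _; rewrite block_mxEur -mulrN mxE; congr (_ * _).
case: n r c B j => [|n] r c B j; first by case: j.
rewrite /cofactor; set N := row' _ _; rewrite (expand_det_col _ 0).
rewrite big_distrr /= -sumrN; apply: eq_bigr => i _.
have lift0 (k : 'I_n.+1) : @lift (1 + n.+1) (lshift n.+1 0) k = rshift 1 k.
  exact/val_inj.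
have liftj0 : @lift (1 + n.+1) (rshift 1 j) 0 = lshift n.+1 0 by exact/val_inj.
have liftj k :
    @lift (1 + n.+1) (rshift 1 j) (@lift n.+1 0 k) = rshift 1 (lift j k).
  by apply/val_inj; rewrite /= /bump /= !add1n ltnS addnS.
have -> : N i 0 = c i 0.
  by rewrite mxE lift0 mxE liftj0 block_mxEdl.
rewrite mulrCA mulrC mxE /cofactor -mulNr; congr (_ * _).
have -> : row' i (col' 0 N) = row' i (col' j B).
  by apply/matrixP=> k l; rewrite 4!mxE lift0 liftj block_mxEdr !mxE.
rewrite mulrA -exprD /= !addn0 addnCA addnA -addnA add1n exprS mulN1r.
by rewrite addnC mulNr.
Qed.

Lemma alternating_minor (R : pzRingType) (n : nat) (M : 'M[R]_n) (i : 'I_n) :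
  alternating M -> alternating (row' i (col' i M)).
Proof.
case=> MT M0; split=> [|k]; last by rewrite !mxE M0.
apply/matrixP=> k l; rewrite !mxE.
by have /matrixP/(_ (lift i k) (lift i l)) := MT; rewrite !mxE.
Qed.

Lemma alternating_drsubmx (R : pzRingType) (m n : nat) (M : 'M[R]_(m + n)) :
  alternating M -> alternating (drsubmx M).
Proof.
case=> MT M0; split=> [|k]; last by rewrite !mxE M0.
by rewrite trmx_drsub MT; apply/matrixP=> k l; rewrite !mxE.
Qed.

Lemma alternating_bordered (R : pzRingType) (n : nat) (M : 'M[R]_(1 + n)) :
  alternating M ->
  M = block_mx (0 : 'M_1) (ursubmx M) (- (ursubmx M)^T) (drsubmx M).
Proof.
case=> MT M0; rewrite -[LHS]submxK; congr block_mx.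
  by apply/matrixP=> i j; rewrite !ord1 !mxE M0.
by rewrite trmx_ursub MT; apply/matrixP=> i j; rewrite !mxE opprK.
Qed.

Lemma cofactor_diag (R : comPzRingType) (n : nat) (A : 'M[R]_n) (i : 'I_n) :
  cofactor A i i = \det (row' i (col' i A)).
Proof. by rewrite /cofactor exprD -expr2 sqrr_sign mul1r. Qed.

Lemma adj_skew (R : comPzRingType) (n : nat) (A : 'M[R]_n) :
  A^T = - A -> (\adj A)^T = (-1) ^+ n.-1 *: \adj A.
Proof. by move=> AT; rewrite trmx_adj AT -scaleN1r adjZ. Qed.

(* The terms are cancelled in pairs, as 2 may be a zero divisor. *)
Lemma alternating_form0 (R : comPzRingType) (n : nat) (A : 'M[R]_n)
    (r : 'rV[R]_n) :
  alternating A -> r *m A *m r^T = 0.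
Proof.
case=> AT A0; apply/matrixP=> x y; rewrite ord1 [y]ord1 -mulmxA mxE [RHS]mxE.
pose f i j := r 0 i * A i j * r 0 j.
have fN i j : f j i = - f i j.
  have /matrixP/(_ i j) := AT; rewrite !mxE /f => ->.
  by rewrite mulrN mulNr mulrC mulrA mulrAC.
transitivity (\sum_i \sum_j f i j).
  apply: eq_bigr => i _; rewrite mxE big_distrr; apply: eq_bigr => j _ /=.
  by rewrite mxE mulrA.
transitivity (\sum_(i < n) \sum_(j < n) ((if (i < j)%N then f i j else 0)
                                  + (if (j < i)%N then f i j else 0))).
  apply: eq_bigr => i _; apply: eq_bigr => j _.
  case: ltngtP => [||/val_inj ->]; rewrite ?addr0 ?add0r //.
  by rewrite /f A0 mulr0 mul0r.
under eq_bigr do rewrite big_split.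
rewrite big_split /= [X in _ + X]exchange_big -big_split big1 //= => i _.
rewrite -big_split big1 //= => j _; case: ifP => _; last exact: addr0.
by rewrite (fN i j) subrr.
Qed.

(** Skew-symmetry alone yields only [\det M = - \det M]. Instead, the adjugate of the block of even
    size is itself alternating: its diagonal entries are alternating minors of odd size, zero by
    induction. *)
Lemma det_alternating_odd (R : comPzRingType) (n : nat) (M : 'M[R]_n) :
  odd n -> alternating M -> \det M = 0.
Proof.
elim/ltn_ind: n M => -[//|n] IHn M /= n_even altM.
rewrite (alternating_bordered altM) det_bordered mulmxN.
have altB := @alternating_drsubmx R 1 n M altM.
rewrite alternating_form0 ?oppr0 ?mxE ?oppr0 //; split=> [|i].
  rewrite adj_skew; last by case: altB.
  (* At [n = 0] the truncated [n.-1] is even and gives the wrong sign, but the matrix is empty. *)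
  case: n {altB IHn} M n_even altM => [|n] M n_even altM.
    by apply/matrixP=> - [].
  have n_odd : odd n := negbNE n_even.
  by rewrite -signr_odd n_odd expr1 scaleN1r.
have n_gt0 : (0 < n)%N by case: (n) i => // - [].
rewrite mxE cofactor_diag IHn //; first by rewrite ltnS leq_pred.
  by case: (n) n_gt0 n_even => //= k _; rewrite negbK.
exact: alternating_minor.
Qed.

(** * Adjugates of singular matrices, and squares *)

Lemma adj_rank1_field (F : fieldType) (n : nat) (A : 'M[F]_n) :
  \det A = 0 -> (\rank (\adj A) <= 1)%N.
Proof.
move=> detA0; have := mul_mx_adj A; rewrite detA0 raddf0.
move=> /mulmx0_rank_max; have [|rkA] := leqP n (\rank A).+1.
  by move=> le1 le2; rewrite -(leq_add2l (\rank A)) addn1 (leq_trans le2).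
(* Here the rank of [A] is below [n - 1], so every minor of size [n - 1] vanishes. *)
rewrite (_ : \adj A = 0) ?mxrank0 //; apply/matrixP=> i j; rewrite !mxE.
rewrite /cofactor (_ : \det _ = 0) ?mulr0 //; apply/eqP.
rewrite -[_ == 0]negbK -unitfE -unitmxE -row_free_unit -row_leq_rank -ltnNge.
have rk1 : (\rank (col' i A) <= \rank A)%N.
  rewrite -mxrank_tr -[X in (_ <= X)%N]mxrank_tr tr_col' row'Esub.
  exact/mxrankS/rowsub_sub.
have rk2 : (\rank (row' j (col' i A)) <= \rank (col' i A))%N.
  by rewrite row'Esub; exact/mxrankS/rowsub_sub.
apply: leq_ltn_trans (leq_trans rk2 rk1) _.
by rewrite ltn_predRL.
Qed.

(** Over the fraction field the adjugate is a column times a row, or zero. *)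
Lemma adj_minor2 (R : idomainType) (n : nat) (A : 'M[R]_n) (i j k l : 'I_n) :
  \det A = 0 -> \adj A i j * \adj A k l = \adj A i l * \adj A k j.
Proof.
move=> detA0; apply/eqP; rewrite -tofrac_eq !rmorphM /=.
pose X := map_mx (@tofrac R) (\adj A).
have XE a b : tofrac (\adj A a b) = X a b by rewrite [RHS]mxE.
rewrite !XE; have : (\rank X <= 1)%N.
  by rewrite /X map_mx_adj adj_rank1_field // det_map_mx detA0 rmorph0.
rewrite -[in X i j](mulmx_base X) -[in X k l](mulmx_base X).
rewrite -[in X i l](mulmx_base X) -[in X k j](mulmx_base X).
move: (col_base X) (row_base X); case: (\rank X) => [|[|//]] C D _.
  by rewrite thinmx0 mul0mx !mxE mul0r.
by rewrite !mxE !big_ord1 mulrACA [X in _ * X]mulrC mulrACA.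
Qed.

Lemma rank1_sym_square (R : idomainType) (n : nat) (S : 'M[R]_n) :
    S^T = S ->
    (forall i j k l, S i j * S k l = S i l * S k j) ->
    (forall i, exists q, S i i = q ^+ 2) ->
  exists p : 'cV[R]_n, S = p *m p^T.
Proof.
move=> ST S2 /fin_all_exists[q Sq].
have SC i j : S i j = S j i by rewrite -[in LHS]ST mxE.
have SqM i j : S i j ^+ 2 = (q i * q j) ^+ 2.
  by rewrite exprMn -!Sq expr2 {2}SC S2.
have [i0 q0|q0] := pickP (fun i => q i != 0); last first.
  exists 0; rewrite mul0mx; apply/matrixP=> i j; rewrite mxE.
  apply/eqP; rewrite -sqrf_eq0 SqM.
  by have /eqP-> := negbFE (q0 i); rewrite mul0r expr0n.
(* As [S i0 j] and [q i0 * q j] agree up to sign, the pivot [q i0] divides its whole row inside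
   [R]. *)
have /fin_all_exists[p Sp] : forall j, exists p, S i0 j = q i0 * p.
  move=> j; have /eqP := SqM i0 j; rewrite eqf_sqr => /orP[]/eqP->.
    by exists (q j).
  by exists (- q j); rewrite mulrN.
exists (\col_j p j); apply/matrixP=> i j; rewrite !mxE big_ord1 !mxE.
apply: (mulfI (expf_neq0 2 q0)); rewrite -[X in X * S i j]Sq S2 (SC i) !Sp.
by rewrite mulrACA -expr2 [p j * _]mulrC.
Qed.

Lemma det_alternating_square (R : idomainType) (n : nat) (M : 'M[R]_n) :
  alternating M -> exists q, \det M = q ^+ 2.
Proof.
elim/ltn_ind: n M => -[|n] IHn M altM.
  by exists 1; rewrite det_mx00 expr1n.
have [n_odd|n_even] := boolP (odd n.+1).
  by exists 0; rewrite det_alternating_odd ?expr0n.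
rewrite (alternating_bordered altM) det_bordered.
have altB := @alternating_drsubmx R 1 n M altM.
set B := drsubmx _ in altB *; set r := ursubmx _.
have n_odd : odd n := negbNE n_even.
have [||i|p ->] := @rank1_sym_square R n (\adj B).
- case: altB => BT _; rewrite adj_skew // -signr_odd.
  have -> : odd n.-1 = false by case: (n) n_odd => //= k /negbTE.
  by rewrite scale1r.
- by move=> i j k l; rewrite adj_minor2 // det_alternating_odd.
- rewrite mxE cofactor_diag; apply: IHn; first by rewrite ltnS leq_pred.
  exact: alternating_minor.
exists ((r *m p) 0 0); rewrite mulmxN mxE opprK -!mulmxA -trmx_mul mulmxA.
by rewrite mxE big_ord1 [_^T _ _]mxE.
Qed.

(** * Realization of polynomials and their squares as determinants *)

Lemma det_skew_block (R : comPzRingType) (n : nat) (A : 'M[R]_n) :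
  \det (block_mx 0 A (- A^T) 0) = \det A ^+ 2.
Proof.
(* The last three factors, of determinant 1, multiply to the block rotation with rows [0, 1] and
   [-1, 0]. *)
have -> : block_mx 0 A (- A^T) 0
        = block_mx A 0 0 A^T *m block_mx 1%:M 1%:M 0 1%:M
          *m block_mx 1%:M 0 (- 1%:M) 1%:M *m block_mx 1%:M 1%:M 0 1%:M.
  rewrite !mulmx_block !(mul0mx, mulmx0, mulmxN, mulmx1, addr0, add0r).
  by rewrite !addrN add0r addNr.
by rewrite !det_mulmx !det_ublock det_lblock !det1 det_tr !mulr1.
Qed.

Section Universality.

Variables (F : fieldType) (m : nat).
Local Notation A := {mpoly F[m]}.

Definition affine_entry (p : A) : Prop := const_or_var p \/ const_or_var (- p).

Definition affine_mx (k n : nat) (M : 'M[A]_(k, n)) : Prop :=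
  forall i j, affine_entry (M i j).

Lemma affine_entryN p : affine_entry p -> affine_entry (- p).
Proof. by case=> ?; [right; rewrite opprK | left]. Qed.

Lemma affine_entryC c : affine_entry c%:MP.
Proof. by left; left; exists c. Qed.

Lemma affine_entryX i : affine_entry 'X_i.
Proof. by left; right; exists i. Qed.

Lemma affine_mxN k n (M : 'M_(k, n)) : affine_mx M -> affine_mx (- M).
Proof. by move=> HM i j; rewrite mxE; exact: affine_entryN. Qed.

Lemma affine_mx_tr k n (M : 'M_(k, n)) : affine_mx M -> affine_mx M^T.
Proof. by move=> HM i j; rewrite mxE. Qed.

Lemma affine_mx_scalar n p : affine_entry p -> affine_mx (p%:M : 'M_n).
Proof.
by move=> Hp i j; rewrite mxE; case: eqP => // _; exact: (affine_entryC 0).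
Qed.

Lemma affine_mx0 k n : affine_mx (0 : 'M_(k, n)).
Proof. by move=> i j; rewrite mxE; exact: (affine_entryC 0). Qed.

Lemma affine_row_mx k n1 n2 (M : 'M_(k, n1)) (N : 'M_(k, n2)) :
  affine_mx M -> affine_mx N -> affine_mx (row_mx M N).
Proof. by move=> HM HN i j; rewrite mxE; case: split. Qed.

Lemma affine_col_mx k1 k2 n (M : 'M_(k1, n)) (N : 'M_(k2, n)) :
  affine_mx M -> affine_mx N -> affine_mx (col_mx M N).
Proof. by move=> HM HN i j; rewrite mxE; case: split. Qed.

(* An algebraic branching program, in matrix form: for [1 - N] strictly
   triangular, [N' = N^-1] sums the weights of the paths between two nodes. *)
Definition abp (Q : A) : Prop :=
  exists n (N N' : 'M[A]_n) (r : 'rV[A]_n) (c : 'cV[A]_n),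
    [/\ affine_mx N, affine_mx r & affine_mx c] /\
    [/\ N *m N' = 1%:M, \det N = 1 & r *m N' *m c = Q%:M].

Lemma abp0 : abp 0.
Proof.
exists 0, 0, 0, 0, 0; split; first by split; exact: affine_mx0.
by split; [apply/matrixP=> - [] | exact: det_mx00 | rewrite !mul0mx raddf0].
Qed.

Lemma abp1 : abp 1.
Proof.
have H1 : affine_mx (1%:M : 'M_1).
  by apply: affine_mx_scalar; exact: (affine_entryC 1).
by exists 1, 1%:M, 1%:M, 1%:M, 1%:M; split; split=> //; rewrite ?mulmx1 ?det1.
Qed.

(** The two programs run in parallel. *)
Lemma abpD P Q : abp P -> abp Q -> abp (P + Q).
Proof.
move=> [n [N [N' [r [c [[HN Hr Hc] [NN' dN eP]]]]]]].
move=> [k [K [K' [s [d [[HK Hs Hd] [KK' dK eQ]]]]]]].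
exists (n + k)%N, (block_mx N 0 0 K), (block_mx N' 0 0 K'),
  (row_mx r s), (col_mx c d).
split; split.
- by apply: affine_col_mx; apply: affine_row_mx => //; exact: affine_mx0.
- exact: affine_row_mx.
- exact: affine_col_mx.
- rewrite mulmx_block !(mul0mx, mulmx0, addr0, add0r) NN' KK'.
  by rewrite -scalar_mx_block.
- by rewrite det_ublock dN dK mulr1.
- rewrite mul_row_block !(mul0mx, mulmx0, addr0, add0r) mul_row_col eP eQ.
  by rewrite raddfD.
Qed.

(** A new node is put in front: it is entered with weight [p] and left along the old row [r]. *)
Lemma abpM p Q : affine_entry p -> abp Q -> abp (p * Q).
Proof.
move=> Hp [n [N [N' [r [c [[HN Hr Hc] [NN' dN eQ]]]]]]].
exists (1 + n)%N, (block_mx 1%:M (- r) 0 N), (block_mx 1%:M (r *m N') 0 N'),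
  (row_mx p%:M 0), (col_mx 0 c).
split; split.
- apply: affine_col_mx; apply: affine_row_mx => //.
  + by apply: affine_mx_scalar; exact: (affine_entryC 1).
  + exact: affine_mxN.
  + exact: affine_mx0.
- by apply: affine_row_mx; [exact: affine_mx_scalar | exact: affine_mx0].
- by apply: affine_col_mx => //; exact: affine_mx0.
- rewrite mulmx_block !(mul0mx, mulmx0, mulmx1, mul1mx, addr0, add0r) NN'.
  by rewrite mulNmx subrr -scalar_mx_block.
- by rewrite det_ublock dN det1 mulr1.
- rewrite mul_row_block !(mul0mx, mulmx0, addr0, add0r) mul_row_col.
  by rewrite mulmx0 add0r -!mulmxA [r *m _]mulmxA eQ -scalar_mxM.
Qed.

Lemma abp_mpoly Q : abp Q.
Proof.
elim/mpolyind: Q => [|c u p _ _ Hp]; first exact: abp0.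
apply: abpD => //; rewrite -mul_mpolyC; apply: abpM; first exact: affine_entryC.
rewrite mpolyXE_id; apply: (big_rec abp) => [|i q _ Hq]; first exact: abp1.
elim: (u i) => [|e IHe]; first by rewrite expr0 mul1r.
by rewrite exprS -mulrA; apply: abpM => //; exact: affine_entryX.
Qed.

Lemma mpoly_det Q : exists n (M : 'M[A]_n), affine_mx M /\ Q = \det M.
Proof.
have [n [N [N' [r [c [[HN Hr Hc] [NN' dN eQ]]]]]]] := abp_mpoly Q.
(* The sign of [- c] cancels the one in [det_bordered]; since [\det N = 1], the adjugate of [N] is
   its inverse [N']. *)
exists (1 + n)%N, (block_mx 0 r (- c) N); split.
  apply: affine_col_mx; apply: affine_row_mx => //; first exact: affine_mx0.
  exact: affine_mxN.
have eN : \adj N = N'.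
  by rewrite -[LHS]mulmx1 -NN' mulmxA mul_adj_mx dN mul1mx.
by rewrite det_bordered eN mulmxN eQ !mxE eqxx opprK.
Qed.

End Universality.

Theorem theorem6p1 (F : fieldType) (m : nat) (P : {mpoly F[m]}) :
  (exists (n : nat) (M : 'M[{mpoly F[m]}]_n),
      [/\ alternating M, entries_const_or_var M & P = \det M])
  <-> (exists Q : {mpoly F[m]}, P = Q ^+ 2).
Proof.
split=> [[n [M [altM _ ->]]]|[Q ->]]; first exact: det_alternating_square.
have [n [M [HM ->]]] := mpoly_det Q.
exists (n + n)%N, (block_mx 0 M (- M^T) 0).
split; last by rewrite det_skew_block.
  split=> [|i].
    by rewrite tr_block_mx opp_block_mx !raddfN /= trmxK !trmx0 oppr0 opprK.
  rewrite -[i]splitK; case: split => k /=.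
    by rewrite block_mxEul mxE.
  by rewrite block_mxEdr mxE.
apply: affine_col_mx; apply: affine_row_mx => //; try exact: affine_mx0.
exact/affine_mxN/affine_mx_tr.
Qed.
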